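(* Let $R$ be a commutative local ring with identity, $M$ a finitely generated distributive $R$-module, and $S$ a multiplicatively closed subset of $R$. If $M$ is coprimely structured (as an $R$-module), then $S^{-1}M$ is coprimely structured (as an $S^{-1}R$-module).
   Context: All modules are unital. A local ring is a ring with a unique maximal ideal. An $R$-module $M$ is distributive if $A\cap(B+C)=(A\cap B)+(A\cap C)$ for all submodules $A,B,C$ of $M$. A prime submodule of an $R$-module $M$ is a proper submodule $P$ such that $rm\in P$ with $r\in R$, $m\in M$ implies $m\in P$ or $rM\subseteq P$. A prime submodule $P$ of $M$ is called coprimely structured if for every family $\{N_i\}_{i\in I}$ of submodules of $M$ with $N_i+P=M$ for all $i\in I$, one has $\bigcap_{i\in I}N_i\not\subseteq P$. A module is called coprimely structured if each of its prime submodules is coprimely structured. *)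

(* Defs.v *)
From HB Require Import structures.
From mathcomp Require Import all_boot all_order all_algebra generic_quotient.
From mathcomp Require Import boolp classical_sets.
From mathcomp Require Import ring.

Set Implicit Arguments.
Unset Strict Implicit.
Unset Printing Implicit Defensive.

Import GRing.Theory.

Local Open Scope ring_scope.
Local Open Scope classical_set_scope.
Local Open Scope quotient_scope.

Section Modules.
Variables (R : comPzRingType) (M : lmodType R).
Implicit Types (A B C P : set M).

Definition is_submodule A : Prop := submod_closed [in A].

Definition submodule_add A B : set M := [set a + b | a in A & b in B].

Definition distributive_module : Prop :=
  forall A B C, is_submodule A -> is_submodule B -> is_submodule C ->
    A `&` submodule_add B C = submodule_add (A `&` B) (A `&` C).

Definition finitely_generated_module : Prop :=
  exists (n : nat) (g : 'I_n -> M),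
    forall x : M, exists c : 'I_n -> R, x = \sum_(i < n) c i *: g i.

Definition prime_submodule P : Prop :=
  [/\ is_submodule P, P <> setT
    & forall (r : R) (m : M), P (r *: m) -> P m \/ (forall x : M, P (r *: x))].

Definition coprimely_structured_submodule P : Prop :=
  prime_submodule P /\
  forall (I : Type) (N : I -> set M),
    (forall i, is_submodule (N i)) ->
    (forall i, submodule_add (N i) P = setT) ->
    ~ (\bigcap_i N i `<=` P).

Definition coprimely_structured_module : Prop :=
  forall P, prime_submodule P -> coprimely_structured_submodule P.

End Modules.

Section LocalRing.
Variable R : comPzRingType.

(* The ideals of R are the submodules of the regular module R^o. *)
Definition is_ideal (I : set R) : Prop := @is_submodule R R^o I.

Definition maximal_ideal (I : set R) : Prop :=
  [/\ is_ideal I, I <> setT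
    & forall J, is_ideal J -> I `<=` J -> J = I \/ J = setT].

Definition local_ring : Prop := exists! I : set R, maximal_ideal I.

End LocalRing.

Section Localization.
Variables (R : comPzRingType) (S : set R) (hS : mulr_closed [in S]).

Definition denom : Type := {s : R | s \in S}.
HB.instance Definition _ := SubChoice.on denom.

Lemma denom1_subproof : (1 : R) \in S.
Proof. by case: hS. Qed.

Lemma denomM_subproof (s t : denom) : sval s * sval t \in S.
Proof. by case: hS => _; apply; [exact: (svalP s)|exact: (svalP t)]. Qed.

Definition denom1 : denom := exist [in S] 1 denom1_subproof.
Definition denomM (s t : denom) : denom := exist [in S] (sval s * sval t) (denomM_subproof s t).

Section Module.
Variable M : lmodType R.

(* R may have zero divisors, hence the extra multiplier u. *)
Definition frac_rel (x y : M * denom) : bool :=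
  `[< exists u : denom,
        sval u *: (sval y.2 *: x.1) = sval u *: (sval x.2 *: y.1) >].

Lemma frac_rel_is_equiv : equiv_class_of frac_rel.
Proof.
split=> [x|x y|y x z].
- by apply/asboolP; exists denom1.
- by apply/asboolP/asboolP => -[u eu]; exists u.
move=> /asboolP[u eu] /asboolP[v ev]; apply/asboolP.
exists (denomM (denomM u v) y.2) => /=.
move: eu ev; case: x y z => [m [s ?]] [n [t ?]] [p [q ?]] /=.
rewrite !scalerA => eu ev.
have -> : sval u * sval v * t * q = (sval v * q) * (sval u * t) by ring.
rewrite -scalerA eu scalerA.
have -> : sval v * q * (sval u * s) = (sval u * s) * (sval v * q) by ring.
rewrite -scalerA ev scalerA; congr (_ *: _); ring.
Qed.

Canonical frac_equiv := EquivRelPack frac_rel_is_equiv.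

Definition localization := {eq_quot frac_equiv}.
HB.instance Definition _ := Choice.on localization.
HB.instance Definition _ := EqQuotient.on localization.

Definition fraction (m : M) (s : denom) : localization :=
  \pi_localization (m, s).

Lemma fractionP (x : localization) : exists m s, x = fraction m s.
Proof.
by exists (repr x).1, (repr x).2; rewrite /fraction -surjective_pairing reprK.
Qed.

Lemma eq_fraction m s n t : fraction m s = fraction n t <->
  exists u : denom, sval u *: (sval t *: m) = sval u *: (sval s *: n).
Proof.
split=> [/eqP|e].
  by rewrite /fraction eqmodE => /asboolP.
by apply/eqP; rewrite /fraction eqmodE; apply/asboolP.
Qed.

Definition loc_add (x y : localization) : localization :=
  let: (m, s) := repr x in let: (n, t) := repr y in
  fraction (sval t *: m + sval s *: n) (denomM s t).

Definition loc_opp (x : localization) : localization :=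
  let: (m, s) := repr x in fraction (- m) s.

Lemma repr_fraction m s : fraction m s = fraction (repr (fraction m s)).1
  (repr (fraction m s)).2.
Proof. by rewrite /fraction -surjective_pairing reprK. Qed.

Lemma loc_addE m s n t : loc_add (fraction m s) (fraction n t) =
  fraction (sval t *: m + sval s *: n) (denomM s t).
Proof.
have := repr_fraction m s; have := repr_fraction n t; rewrite /loc_add.
case: (repr (fraction m s)) => m' s'; case: (repr (fraction n t)) => n' t' /=.
move=> /eq_fraction[u eu] /eq_fraction[v ev]; apply/eq_fraction.
exists (denomM u v) => /=; move: eu ev; rewrite !scalerDr !scalerA => eu ev.
have -> : sval u * sval v * (sval s * sval t) * sval t' =
  (sval u * sval t * sval t') * (sval v * sval s) by ring.
have -> : sval u * sval v * (sval s * sval t) * sval s' =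
  (sval v * sval s * sval s') * (sval u * sval t) by ring.
rewrite -[in LHS]scalerA -ev -[X in _ + X]scalerA -eu !scalerA.
by congr (_ *: _ + _ *: _); ring.
Qed.

Lemma loc_oppE m s : loc_opp (fraction m s) = fraction (- m) s.
Proof.
have := repr_fraction m s; rewrite /loc_opp.
case: (repr (fraction m s)) => m' s' /= /eq_fraction[u eu].
by apply/eq_fraction; exists u; rewrite !scalerN eu.
Qed.

Lemma loc_addA : associative loc_add.
Proof.
move=> x y z; have [m [s ->]] := fractionP x.
have [n [t ->]] := fractionP y; have [p [q ->]] := fractionP z.
rewrite !loc_addE; apply/eq_fraction; exists denom1 => /=.
rewrite !scalerDr !scalerA addrA.
by congr (_ *: _ + _ *: _ + _ *: _); ring.
Qed.

Lemma loc_addC : commutative loc_add.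
Proof.
move=> x y; have [m [s ->]] := fractionP x; have [n [t ->]] := fractionP y.
rewrite !loc_addE addrC; apply/eq_fraction; exists denom1 => /=.
by rewrite [sval t * _]mulrC.
Qed.

Lemma loc_add0 : left_id (fraction 0 denom1) loc_add.
Proof.
move=> x; have [m [s ->]] := fractionP x.
rewrite loc_addE scaler0 add0r /= scale1r; apply/eq_fraction.
by exists denom1; rewrite /= mul1r.
Qed.

Lemma loc_addN : left_inverse (fraction 0 denom1) loc_opp loc_add.
Proof.
move=> x; have [m [s ->]] := fractionP x.
rewrite loc_oppE loc_addE scalerN addNr; apply/eq_fraction.
by exists denom1; rewrite !scaler0.
Qed.

HB.instance Definition _ :=
  GRing.isZmodule.Build localization loc_addA loc_addC loc_add0 loc_addN.

Lemma addfE m s n t : fraction m s + fraction n t =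
  fraction (sval t *: m + sval s *: n) (denomM s t).
Proof. exact: loc_addE. Qed.

Lemma fraction0 s : fraction 0 s = 0.
Proof. by apply/eq_fraction; exists denom1; rewrite !scaler0. Qed.

End Module.

Definition localization_ring : Type := localization R^o.
HB.instance Definition _ := GRing.Zmodule.on localization_ring.

Definition ring_fraction (r : R) (s : denom) : localization_ring :=
  fraction (r : R^o) s.

Lemma ring_fractionP (x : localization_ring) : exists r s, x = ring_fraction r s.
Proof. exact: (@fractionP R^o). Qed.

(* The action (r / s) (m / t) = (r m) / (s t); for M = R^o it is also the
   multiplication of the localized ring. *)
Definition loc_scale (M : lmodType R) (a : localization_ring)
    (x : localization M) : localization M :=
  let: (r, s) := repr a in let: (m, t) := repr x in
  fraction ((r : R) *: m) (denomM s t).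

Lemma loc_scaleE (M : lmodType R) r s (m : M) t :
  loc_scale (ring_fraction r s) (fraction m t) =
  fraction (r *: m) (denomM s t).
Proof.
have := repr_fraction (r : R^o) s; have := repr_fraction m t.
rewrite /loc_scale /ring_fraction.
case: (repr (fraction (r : R^o) s)) => r' s'.
case: (repr (fraction m t)) => m' t' /=.
move=> /eq_fraction[u eu] /eq_fraction[v ev]; apply/eq_fraction.
exists (denomM u v) => /=; move: eu ev.
rewrite !scalerA => eu ev.
have {}ev : sval v * sval s' * r = sval v * sval s * r' by [].
have -> : sval u * sval v * (sval s * sval t) * r' =
  sval u * sval t * (sval v * sval s * r') by ring.
rewrite -ev.
have -> : sval u * sval t * (sval v * sval s' * r) =
  (sval v * sval s' * r) * (sval u * sval t) by ring.
rewrite -[LHS]scalerA -eu scalerA; congr (_ *: _); ring.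
Qed.

Definition loc_mul : localization_ring -> localization_ring ->
  localization_ring := @loc_scale R^o.

Lemma loc_mulE r s r' s' : loc_mul (ring_fraction r s) (ring_fraction r' s') =
  ring_fraction (r * r') (denomM s s').
Proof. exact: (@loc_scaleE R^o). Qed.

Definition loc_one : localization_ring := ring_fraction 1 denom1.

Lemma eq_ring_fraction r s r' s' : ring_fraction r s = ring_fraction r' s' <->
  exists u : denom, sval u * (sval s' * r) = sval u * (sval s * r').
Proof. exact: eq_fraction. Qed.

Lemma add_ring_fractionE r s r' s' : ring_fraction r s + ring_fraction r' s' =
  ring_fraction (sval s' * r + sval s * r') (denomM s s').
Proof. exact: addfE. Qed.

Lemma loc_mulA : associative loc_mul.
Proof.
move=> x y z; have [m [s ->]] := ring_fractionP x.
have [n [t ->]] := ring_fractionP y; have [p [q ->]] := ring_fractionP z.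
rewrite !loc_mulE; apply/eq_ring_fraction; exists denom1 => /=; ring.
Qed.

Lemma loc_mulC : commutative loc_mul.
Proof.
move=> x y; have [m [s ->]] := ring_fractionP x.
have [n [t ->]] := ring_fractionP y.
rewrite !loc_mulE; apply/eq_ring_fraction; exists denom1 => /=; ring.
Qed.

Lemma loc_mul1 : left_id loc_one loc_mul.
Proof.
move=> x; have [m [s ->]] := ring_fractionP x.
rewrite loc_mulE; apply/eq_ring_fraction; exists denom1 => /=; ring.
Qed.

Lemma loc_mulDl : left_distributive loc_mul +%R.
Proof.
move=> x y z; have [m [s ->]] := ring_fractionP x.
have [n [t ->]] := ring_fractionP y; have [p [q ->]] := ring_fractionP z.
rewrite add_ring_fractionE !loc_mulE add_ring_fractionE.
apply/eq_ring_fraction; exists denom1 => /=; ring.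
Qed.

HB.instance Definition _ := GRing.Zmodule_isComPzRing.Build localization_ring
  loc_mulA loc_mulC loc_mul1 loc_mulDl.

Section ModuleStructure.
Variable M : lmodType R.

Lemma loc_scaleA (a b : localization_ring) (x : localization M) :
  loc_scale a (loc_scale b x) = loc_scale (a * b) x.
Proof.
have [r [s ->]] := ring_fractionP a; have [r' [t ->]] := ring_fractionP b.
have [m [q ->]] := fractionP x.
rewrite [ring_fraction _ _ * _]loc_mulE !loc_scaleE.
apply/eq_fraction; exists denom1 => /=; rewrite !scalerA.
congr (_ *: _); ring.
Qed.

Lemma loc_scale1 : left_id (1 : localization_ring) (@loc_scale M).
Proof.
move=> x; have [m [q ->]] := fractionP x.
rewrite -[1 in LHS]/loc_one loc_scaleE; apply/eq_fraction; exists denom1 => /=.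
by rewrite !scale1r mul1r.
Qed.

Lemma loc_scaleDr : right_distributive (@loc_scale M) +%R.
Proof.
move=> a x y; have [r [s ->]] := ring_fractionP a.
have [m [t ->]] := fractionP x; have [n [q ->]] := fractionP y.
rewrite addfE !loc_scaleE addfE; apply/eq_fraction; exists denom1 => /=.
rewrite !scalerDr !scalerA; congr (_ *: _ + _ *: _); ring.
Qed.

Lemma loc_scaleDl (x : localization M) :
  {morph (@loc_scale M)^~ x : a b / a + b}.
Proof.
move=> a b /=; have [r [s ->]] := ring_fractionP a.
have [r' [t ->]] := ring_fractionP b; have [m [q ->]] := fractionP x.
rewrite add_ring_fractionE !loc_scaleE addfE.
apply/eq_fraction; exists denom1 => /=.
rewrite !scalerDl !scalerDr !scalerA; congr (_ *: _ + _ *: _); ring.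
Qed.

HB.instance Definition _ := GRing.Zmodule_isLmodule.Build localization_ring
  (localization M) loc_scaleA loc_scale1 loc_scaleDr loc_scaleDl.

Lemma scalefE r s (m : M) t :
  ring_fraction r s *: fraction m t = fraction (r *: m) (denomM s t).
Proof. exact: loc_scaleE. Qed.

End ModuleStructure.

Lemma mul_ring_fractionE r s r' s' : ring_fraction r s * ring_fraction r' s' =
  ring_fraction (r * r') (denomM s s').
Proof. exact: loc_mulE. Qed.

End Localization.

(* Main.v *)
(** Over a local ring, distributivity applied to [R (x + y)], [R x] and [R y]
    yields [r] with [r y] in [R x] and [(1 - r) x] in [R y]; as [r] or [1 - r]
    is invertible, any two elements of [M] are comparable for divisibility.
    This passes to [S^-1 M], whose submodules therefore form a chain.  In a
    module whose submodules form a chain, [N + P = M] with [P] proper forces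
    [N = M], so every prime submodule is coprimely structured. *)
Require Import Defs.
From mathcomp Require Import all_boot all_order all_algebra.
From mathcomp Require Import boolp classical_sets.

Set Implicit Arguments.
Unset Strict Implicit.
Unset Printing Implicit Defensive.

Local Open Scope ring_scope.
Local Open Scope classical_set_scope.

Import GRing.Theory.

Section Submodules.
Variables (R : comPzRingType) (M : lmodType R).

Lemma is_submoduleP (A : set M) : is_submodule A <->
  A 0 /\ forall a u v, A u -> A v -> A (a *: u + v).
Proof.
split=> [[A0 AD]|[A0 AD]].
- split=> [|a u v Au Av]; first by move: A0; rewrite inE.
  by have := AD a u v; rewrite !inE; apply.
- split=> [|a u v]; first by rewrite inE.
  by rewrite !inE; exact: AD.
Qed.

Lemma submoduleZ (A : set M) a u : is_submodule A -> A u -> A (a *: u).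
Proof.
by move=> /is_submoduleP[A0 AD] Au; rewrite -[_ *: _]addr0; exact: AD.
Qed.

Lemma submoduleD (A : set M) u v : is_submodule A -> A u -> A v -> A (u + v).
Proof.
by move=> /is_submoduleP[_ AD] Au Av; rewrite -[u]scale1r; exact: AD.
Qed.

Definition cyclic_submodule (x : M) : set M := [set a *: x | a in setT].

Lemma cyclic_submodule_is_submodule x : is_submodule (cyclic_submodule x).
Proof.
apply/is_submoduleP; split; first by exists 0; rewrite ?scale0r.
move=> a _ _ [b _ <-] [c _ <-]; exists (a * b + c) => //.
by rewrite scalerDl scalerA.
Qed.

Lemma mem_cyclic_submodule x : cyclic_submodule x x.
Proof. by exists 1; rewrite ?scale1r. Qed.

(** This elementwise form says that the submodules form a chain: if [x] lies in [A] but not in [B],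
    no [y] in [B] divides [x], so [x] divides each of them and [B] is contained in [A]. *)
Definition uniserial : Prop :=
  forall x y : M, cyclic_submodule y x \/ cyclic_submodule x y.

Lemma distributive_comaximal x y : distributive_module M ->
  exists r, cyclic_submodule x (r *: y) /\ cyclic_submodule y ((1 - r) *: x).
Proof.
move=> /(_ (cyclic_submodule (x + y)) (cyclic_submodule x)
          (cyclic_submodule y)) dM.
have {dM} := dM (cyclic_submodule_is_submodule _)
  (cyclic_submodule_is_submodule _) (cyclic_submodule_is_submodule _).
move=> /seteqP[/(_ (x + y)) dM _]; case: dM.
  split; first exact: mem_cyclic_submodule.
  exists x; first exact: mem_cyclic_submodule.
  by exists y; first exact: mem_cyclic_submodule.
(* The first summand is [r (x + y) = c x], whence [r y = (c - r) x]. The second is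
   [b = (1 - r) (x + y) = d y], whence [(1 - r) x = (d - (1 - r)) y]. *)
move=> _ [[r _ <-] [c _ ecx]] [b [_ [d _ edy]] exy].
exists r; split.
  by exists (c - r) => //; rewrite scalerBl ecx scalerDr addrC addKr.
exists (d - (1 - r)) => //; rewrite scalerBl edy.
have -> : b = (1 - r) *: (x + y) by rewrite scalerBl scale1r -{1}exy addrC addKr.
by rewrite scalerDr addrK.
Qed.

Lemma uniserial_coprimely_structured :
  uniserial -> coprimely_structured_module M.
Proof.
move=> uM P primeP; split=> // I N subN NP sub.
have [subP Pneq _] := primeP.
have [z nPz] : exists z, ~ P z.
  by apply/existsNP => PT; apply: Pneq; rewrite -subTset => z _; exact: PT.
(* It suffices that [z], chosen outside [P], lies in every [N i]. Write [z = n + p]: if [n] divides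
   [p], then [z] is in [N i]; if [p] divides [n], then [z] is in [P], a contradiction. *)
apply: (nPz); apply: sub => i _.
have [n Nn [p Pp enp]] : submodule_add (N i) P z by rewrite NP.
rewrite -enp; apply: submoduleD => //.
have [[c _ <-]|[c _ ecp]] := uM p n; first exact: submoduleZ.
case: nPz; rewrite -enp -ecp; apply: submoduleD => //; first exact: submoduleZ.
Qed.

End Submodules.

Section LocalRings.
Variable R : comPzRingType.

Lemma ideal_eqT (I : set R) : is_ideal I -> I 1 -> I = setT.
Proof.
move=> idI I1; rewrite -subTset => r _.
by rewrite -[r]mulr1; exact: (@submoduleZ R R^o I r 1 idI I1).
Qed.

Lemma exists_maximal_ideal (I : set R) : is_ideal I -> ~ I 1 ->
  exists2 m, maximal_ideal m & I `<=` m.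
Proof.
move=> idI nI1.
(* Zorn_bigcup also asks for an upper bound of the empty chain, so chains are
   taken among sets that become proper ideals once [I] is added. *)
pose P := [set J : set R | is_ideal (J `|` I) /\ ~ (J `|` I) 1].
have P0 : P set0 by split; rewrite set0U.
have [|A [[idA nA1] maxA]] := @Zorn_bigcup R P.
  (* Closure and properness are tested inside a single [K]: the larger of two chain members, or
     [set0] when both elements come from [I]. *)
  move=> F FP Ftot; have pair u v : (\bigcup_(X in F) X `|` I) u ->
      (\bigcup_(X in F) X `|` I) v ->
      exists K, [/\ P K, K `<=` \bigcup_(X in F) X, (K `|` I) u & (K `|` I) v].
    have subF X : F X -> X `<=` \bigcup_(X in F) X.
      by move=> FX w Xw; exists X.
    move=> [[X FX Xu]|Iu] [[Y FY Yv]|Iv].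
    - have [XY|YX] := Ftot X Y FX FY.
      + by exists Y; split; [exact: FP|exact: subF|left; exact: XY|left].
      + by exists X; split; [exact: FP|exact: subF|left|left; exact: YX].
    - by exists X; split; [exact: FP|exact: subF|left|right].
    - by exists Y; split; [exact: FP|exact: subF|right|left].
    - by exists set0; split => //; right.
  split=> [|F1].
    apply/is_submoduleP; split.
      by right; have /is_submoduleP[] := idI.
    move=> a u v Fu Fv.
    have [K [[/is_submoduleP[_ KD] _] KF Ku Kv]] := pair _ _ Fu Fv.
    by have [/KF|] := KD a u v Ku Kv; [left|right].
  by have [K [[_ nK1] _ K1 _]] := pair _ _ F1 F1.
exists (A `|` I); last by move=> x; right.
split=> // [AT|J idJ AJ]; first by apply: nA1; rewrite AT.
have [J1|nJ1] := pselect (J 1); [right; exact: ideal_eqT|left].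
have JI : J `|` I = J by apply/setUidPl => x Ix; apply: AJ; right.
(* A point of [J] outside [A] would make [J] a member of [P] strictly larger than [A]. *)
apply/seteqP; split=> // x Jx; left; apply: contrapT => nAx.
apply: (maxA J); last by split; rewrite JI.
by split=> [y Ay|/(_ x Jx)//]; apply: AJ; left.
Qed.

(** A nonunit generates a proper ideal, hence lies in the unique maximal ideal [m]. Were [r] and
    [1 - r] both nonunits, their sum [1] would be in [m]. *)
Lemma local_ring_invertible (r : R) : local_ring R ->
  (exists s, s * r = 1) \/ (exists s, s * (1 - r) = 1).
Proof.
move=> [m [[idm neqm _] uniqm]].
have nonunit (x : R) : ~ (exists s, s * x = 1) -> m x.
  move=> nx; have [|[s _ sx]|m' maxm' xm'] :=
    @exists_maximal_ideal (@cyclic_submodule R R^o x).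
  - exact: cyclic_submodule_is_submodule.
  - by apply: nx; exists s.
  - by rewrite (uniqm _ maxm'); apply: xm'; exact: mem_cyclic_submodule.
apply: contrapT => /not_orP[/nonunit mr /nonunit m1r].
apply: neqm; apply: ideal_eqT => //.
by rewrite -[1](subrK r); exact: (@submoduleD R R^o).
Qed.

Lemma local_distributive_uniserial (M : lmodType R) :
  local_ring R -> distributive_module M -> uniserial M.
Proof.
move=> locR dM x y; have [r [rx ry]] := distributive_comaximal x y dM.
have [[s sr]|[s sr]] := local_ring_invertible r locR; [right|left].
- rewrite -[y]scale1r -sr -scalerA.
  by apply: submoduleZ => //; exact: cyclic_submodule_is_submodule.
- rewrite -[x]scale1r -sr -scalerA.
  by apply: submoduleZ => //; exact: cyclic_submodule_is_submodule.
Qed.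

End LocalRings.

Lemma localization_uniserial (R : comPzRingType) (M : lmodType R)
    (S : set R) (hS : GRing.mulr_closed [in S]) :
  uniserial M -> @uniserial (localization_ring hS) (localization hS M).
Proof.
move=> uM.
have divf m s n t : cyclic_submodule n m ->
    @cyclic_submodule (localization_ring hS) (localization hS M)
      (fraction hS n t) (fraction hS m s).
  (* With [m = c n], the factor [t c / s] cancels the denominator [t] and restores [s]:
     [(t c / s) (n / t) = m / s]. *)
  move=> [c _ <-]; exists (ring_fraction hS (sval t * c) s) => //.
  rewrite scalefE; apply/eq_fraction; exists (denom1 hS) => /=.
  by rewrite !scalerA !mulrA.
move=> x y; have [m [s ->]] := fractionP x; have [n [t ->]] := fractionP y.
by have [mn|nm] := uM m n; [left|right]; exact: divf.
Qed.

Theorem theorem3p4 (R : comPzRingType) (M : lmodType R)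
    (S : set R) (hS : GRing.mulr_closed [in S]) :
  local_ring R ->
  finitely_generated_module M ->
  distributive_module M ->
  coprimely_structured_module M ->
  @coprimely_structured_module (localization_ring hS) (localization hS M).
Proof.
move=> locR _ dM _; apply: uniserial_coprimely_structured.
exact/localization_uniserial/local_distributive_uniserial.
Qed.
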